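(* Suppose that the supremum of the Shannon capacity $c(G)$ over all finite graphs $G$ with independence number $\alpha(G)=2$ is finite, and call it $C$. Then for every finite graph $G$ with $\alpha(G)=2$ and every positive integer $n$, we have $C>\alpha(G^n)^{1/n}$.
   Context: Graphs are finite, simple, undirected and loopless; $\alpha(G)$ is the maximum size of a set of pairwise non-adjacent vertices of $G$. For graphs $G_1=(V_1,E_1),\dots,G_n=(V_n,E_n)$, the product $G_1\times\cdots\times G_n$ is the graph on vertex set $V_1\times\cdots\times V_n$ in which two distinct vertices $(u_1,\dots,u_n)$ and $(v_1,\dots,v_n)$ are adjacent if and only if for every $i$, either $u_i=v_i$ or $\{u_i,v_i\}\in E_i$. $G^n$ denotes the $n$-fold product $G\times\cdots\times G$. The Shannon capacity of $G$ is $c(G)=\lim_{n\to\infty}\alpha(G^n)^{1/n}$ (this limit exists). *)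

(* Defs.v *)
From mathcomp Require Import all_boot all_order all_algebra.
From mathcomp Require Import all_classical all_reals all_analysis.

Set Implicit Arguments.
Unset Strict Implicit.
Unset Printing Implicit Defensive.

Import Order.TTheory GRing.Theory Num.Theory.
Import numFieldNormedType.Exports.

Local Open Scope classical_set_scope.
Local Open Scope ring_scope.

Record sgraph := SGraph {
  vertex :> finType;
  adj : rel vertex;
  adj_sym : symmetric adj;
  adj_irrefl : irreflexive adj
}.

Definition independent (G : sgraph) (A : {set G}) : bool :=
  [forall x in A, forall y in A, ~~ adj x y].

Definition alpha (G : sgraph) : nat :=
  \max_(A : {set G} | independent A) #|A|.

Section Product.
Variables (n : nat) (G : 'I_n -> sgraph).

Definition prod_vertex : finType := {dffun forall i : 'I_n, G i}.

Definition prod_adj : rel prod_vertex :=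
  fun u v => (u != v) && [forall i, (u i == v i) || adj (u i) (v i)].

Lemma prod_adj_sym : symmetric prod_adj.
Proof.
move=> u v; rewrite /prod_adj eq_sym; congr (_ && _).
by apply: eq_forallb => i; rewrite eq_sym adj_sym.
Qed.

Lemma prod_adj_irrefl : irreflexive prod_adj.
Proof. by move=> u; rewrite /prod_adj eqxx. Qed.

Definition gprod : sgraph := SGraph prod_adj_sym prod_adj_irrefl.

End Product.

Definition gpow (G : sgraph) (n : nat) : sgraph := gprod (fun _ : 'I_n => G).

(* alpha (G^n)^(1/n); the value at n = 0 is 1 and plays no role. *)
Definition alpha_root (R : realType) (G : sgraph) (n : nat) : R :=
  (alpha (gpow G n))%:R `^ n%:R^-1.

(* [lim] is total, but by supermultiplicativity of alpha on powers and Fekete's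
   lemma the limit always exists. *)
Definition shannon_capacity (R : realType) (G : sgraph) : R :=
  lim (alpha_root R G n @[n --> \oo]).

(* Taken in the extended reals, so that it is meaningful (and equal to +oo)
   when the capacities are unbounded. *)
Definition sup_capacity (R : realType) : \bar R :=
  ereal_sup [set c |
    exists G : sgraph, alpha G = 2 /\ c = (shannon_capacity R G)%:E].

(* Main.v *)
Require Import Defs.
From mathcomp Require Import all_boot all_order all_algebra.
From mathcomp Require Import all_classical all_reals all_analysis.
From mathcomp Require Import ring lra.

Set Implicit Arguments.
Unset Strict Implicit.
Unset Printing Implicit Defensive.

Import Order.TTheory GRing.Theory Num.Theory.
Import numFieldNormedType.Exports.

Local Open Scope ring_scope.

(** A graph [G] with [alpha G = 2] and an independent set of size [m] in [G^n]
    give a colouring with [n] colours of the edges of [K_m] without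
    monochromatic triangles (the colours of a pair are the coordinates at which
    it is distinct and non-adjacent); conversely, every such colouring of [K_m]
    comes from a single graph of independence number 2.  Two copies of the
    colouring, on disjoint palettes, yield one of [K_(m^2)] with [2n] colours,
    and this product colouring can be modified so as to admit one more vertex.
    So some [H] with [alpha H = 2] has [alpha (H^(2n)) > m^2], and by Fekete's
    lemma the capacity of [H] is at least [alpha (H^(2n))^(1/(2n))]. *)

(** * Independent sets, and the colouring read off a power *)

Lemma leq_alpha (G : sgraph) (T : finType) (f : T -> G) :
  injective f -> (forall x y, ~~ adj (f x) (f y)) -> (#|T| <= alpha G)%N.
Proof.
move=> f_inj f_ind; rewrite -cardsT -(card_imset _ f_inj).
apply: leq_bigmax_cond; apply/forall_inP => _ /imsetP[x _ ->].
by apply/forall_inP => _ /imsetP[y _ ->].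
Qed.

Lemma alpha_attained (G : sgraph) : exists f : 'I_(alpha G) -> G,
  injective f /\ forall x y, ~~ adj (f x) (f y).
Proof.
have ind0 : independent (finset.set0 : {set G}).
  by apply/forall_inP => x; rewrite inE.
have [] := @eq_bigmax_cond _ (@independent G) (fun A : {set G} => #|A|).
  by apply/card_gt0P; exists finset.set0.
rewrite -/(alpha G) => A indA ->; exists enum_val; split; first exact: enum_val_inj.
move=> x y; move/forall_inP: indA => /(_ _ (enum_valP x)) /forall_inP.
by apply; exact: enum_valP.
Qed.

Lemma gprod_nadjP (n : nat) (G : 'I_n -> sgraph) (u v : gprod G) : u != v ->
  reflect (exists i, (u i != v i) && ~~ adj (u i) (v i)) (~~ adj u v).
Proof.
move=> uv; rewrite /= /prod_adj uv /= negb_forall.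
by under eq_existsb do rewrite negb_or; exact: existsP.
Qed.

(* The classes [E i] may overlap: a pair can carry several colours.
   Irreflexivity is the case [x = y = z] of the second condition. *)
Definition triangle_free_cover (I T : finType) (E : I -> rel T) : Prop :=
  [/\ forall i, symmetric (E i),
      forall i x y z, E i x y -> E i y z -> ~~ E i x z
    & forall x y, x != y -> exists i, E i x y].

Lemma alpha_lt3 (G : sgraph) (x y z : G) : alpha G = 2%N ->
  [&& x != y, y != z & z != x] ->
  [|| adj x y, adj y z | adj z x].
Proof.
move=> aG /and3P[xy yz zx]; apply/negPn/negP; rewrite !negb_or => /and3P[axy ayz azx].
have ind : independent [set a in [:: x; y; z]].
  apply/forall_inP => a; rewrite !inE => ha.
  apply/forall_inP => b; rewrite !inE => hb.
  by case/or3P: ha => /eqP->; case/or3P: hb => /eqP->; rewrite ?adj_irrefl // adj_sym.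
have := @leq_bigmax_cond _ (@independent G) (fun A : {set G} => #|A|) _ ind.
rewrite -/(alpha G) aG cardsE.
have /card_uniqP-> // : uniq [:: x; y; z].
by rewrite /= !inE negb_or xy yz eq_sym zx.
Qed.

(** A triangle in the class of coordinate [i] would project to three pairwise non-adjacent vertices
    of [G]. *)
Lemma cover_of_gpow (G : sgraph) (n : nat) : alpha G = 2%N ->
  exists E : 'I_n -> rel 'I_(alpha (gpow G n)), triangle_free_cover E.
Proof.
move=> aG; have [f [f_inj f_ind]] := alpha_attained (gpow G n).
exists (fun i x y => (f x i != f y i) && ~~ adj (f x i) (f y i)); split.
- by move=> i x y; rewrite eq_sym adj_sym.
- move=> i x y z /andP[xy axy] /andP[yz ayz]; apply/negP => /andP[xz axz].
  have := @alpha_lt3 G (f x i) (f y i) (f z i) aG.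
  by rewrite xy yz eq_sym xz (negPf axy) (negPf ayz) adj_sym (negPf axz) => /(_ isT).
- by move=> x y xy; apply/gprod_nadjP => //; rewrite (inj_eq f_inj).
Qed.

(** * The graph of a colouring *)

Section CoverGraph.
Variables (I T : finType) (E : I -> rel T).
Hypothesis (E_cover : triangle_free_cover E).

(** The complement of the disjoint union of the graphs [(T, E i)]. *)
Definition cover_adj : rel (I * T) :=
  fun p q => (p.1 != q.1) || (p.2 != q.2) && ~~ E p.1 p.2 q.2.

Lemma cover_adj_sym : symmetric cover_adj.
Proof.
case: E_cover => symE _ _ [i x] [j y]; rewrite /cover_adj /= eq_sym.
by case: eqP => //= ->; rewrite eq_sym symE.
Qed.

Lemma cover_adj_irrefl : irreflexive cover_adj.
Proof. by move=> p; rewrite /cover_adj !eqxx. Qed.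

Definition cover_graph : sgraph := SGraph cover_adj_sym cover_adj_irrefl.

Lemma cover_nadj (p q : cover_graph) : ~~ adj p q -> p != q ->
  p.1 = q.1 /\ E p.1 p.2 q.2.
Proof.
case: p q => [i x] [j y]; rewrite /= /cover_adj /= negb_or negbK negb_and !negbK.
by case/andP=> /eqP <- /orP[/eqP->|]; rewrite ?eqxx.
Qed.

(** Independent sets are cliques in a disjoint union of triangle-free graphs; any edge of a colour
    class gives size 2. *)
Lemma alpha_cover_graph : (1 < #|T|)%N -> alpha cover_graph = 2%N.
Proof.
case: E_cover => symE triE covE /card_gt1P[x [y [_ _ xy]]].
apply/eqP; rewrite eqn_leq; apply/andP; split.
  apply/bigmax_leqP => A /forall_inP indA; rewrite leqNgt; apply/negP.
  case/card_gt2P => p [q [r [[pA qA rA] [pq qr rp]]]].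
  have ind a b : a \in A -> b \in A -> ~~ adj a b.
    by move=> aA; move: b; exact/forall_inP/indA.
  have [epq Epq] := cover_nadj (ind _ _ pA qA) pq.
  have [eqr Eqr] := cover_nadj (ind _ _ qA rA) qr.
  have [erp Erp] := cover_nadj (ind _ _ rA pA) rp.
  rewrite -epq in Eqr; rewrite erp in Erp; rewrite symE in Erp.
  by have := triE _ _ _ _ Epq Eqr; rewrite Erp.
have [i Exy] := covE _ _ xy; rewrite -card_bool.
apply: (@leq_alpha _ _ (fun b : bool => (i, if b then x else y) : cover_graph)).
  by case=> [] [] // [] /eqP; rewrite ?[y == x]eq_sym (negPf xy).
by case=> [] []; rewrite /= /cover_adj /= ?eqxx //= 1?[E i y x]symE Exy andbF.
Qed.

(** Each [x] is sent to the tuple of its copies in all layers; a colour of a pair names a coordinate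
    where the two images are distinct and non-adjacent. *)
Lemma leq_alpha_gpow_cover : (#|T| <= alpha (gpow cover_graph #|I|))%N.
Proof.
case: E_cover => _ _ covE.
pose f (x : T) : gpow cover_graph #|I| := [ffun i => (enum_val i, x)].
have fE x i : f x i = (enum_val i, x) by rewrite ffunE.
have [T0|] := posnP #|T|; first by rewrite T0.
case/card_gt0P => x0 _.
have f_inj : injective f.
  move=> x y; have [// | xy] := eqVneq x y; have [i _] := covE _ _ xy.
  by move/(congr1 (fun u : gpow cover_graph #|I| => (u (enum_rank i)).2)); rewrite !fE.
apply: (leq_alpha f_inj) => x y.
have [->|xy] := eqVneq x y; first by rewrite adj_irrefl.
have [i Exy] := covE _ _ xy.
apply/gprod_nadjP; first by rewrite (inj_eq f_inj).
exists (enum_rank i); rewrite !fE enum_rankK /= /cover_adj /= eqxx Exy.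
by rewrite andbF /= andbT xpair_eqE eqxx.
Qed.

End CoverGraph.

(** * The product colouring with one more vertex *)

Section Doubling.
Variables (I T : finType) (E : I -> rel T) (j : I) (o : T).
Hypothesis (E_cover : triangle_free_cover E).

(* Besides the product colouring [base] of [T * T], [None] is a clone of
   [(o, o)], joined to it by colour [inl j].  With [N] the [E j]-neighbourhood
   of [o], both vertices would see [N * T] in colour [inl j].  This is resolved
   by splitting [N * T]: [None] keeps [inl j] towards [N * N] and uses [inr j]
   towards [N * {o}]; [(o, o)] does the opposite, and keeps [inl j] towards the
   rest of [N * T].  [nbr true] and [nbr false] are the neighbourhoods of
   [(o, o)] and [None], respectively. *)
Let nbr (z : bool) (c : I + I) (p : T * T) : bool :=
  match c with
  | inl i => if i == j then E j o p.1 && (z (+) E j o p.2) else E i o p.1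
  | inr i =>
    if i == j then
      ((p.1 == o) || z && E j o p.1) && E j o p.2
      || [&& ~~ z, E j o p.1 & p.2 == o]
    else ((p.1 == o) || ~~ z && E j o p.1) && E i o p.2
  end.

(** The lexicographic product of the colouring with itself: the second palette serves pairs that
    agree in the first coordinate. *)
Let base (c : I + I) (p q : T * T) : bool :=
  match c with
  | inl i => E i p.1 q.1
  | inr i => (p.1 == q.1) && E i p.2 q.2
  end.

Definition double_cover (c : I + I) : rel (option (T * T)) := fun s t =>
  match s, t with
  | None, None => false
  | None, Some p | Some p, None =>
    if p == (o, o) then c == inl j else nbr false c p
  | Some p, Some q =>
    if p == (o, o) then nbr true c q
    else if q == (o, o) then nbr true c p
    else base c p q
  end.

Lemma double_coverP : triangle_free_cover double_cover.
Proof.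
case: E_cover => symE triE covE.
have irrE i x : E i x x = false.
  by apply/negP => Exx; have := triE _ _ _ _ Exx Exx; rewrite Exx.
have triE' i x y : E i o x -> E i o y -> E i x y = false.
  by rewrite symE => ox oy; apply/negP => xy; have := triE _ _ _ _ ox oy; rewrite xy.
have nbr0 z c : nbr z c (o, o) = false.
  by case: c => i; rewrite /= !irrE ?andbF ?if_same.
have baseC c : symmetric (base c).
  by move=> p q; case: c => i; rewrite /= symE // eq_sym.
have dsym c : symmetric (double_cover c).
  move=> [p|] [q|] //=; case: (p =P _) => [?|_]; case: (q =P _) => [?|_]; subst=> //.
  by rewrite baseC.
(* Excludes monochromatic triangles with exactly one of [(o, o)] and [None] as a vertex. *)
have nbr_base z c p q : nbr z c p -> nbr z c q -> base c p q -> False.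
  case: p q => [x y] [x' y']; case: c => i /=; have [->|ij] := eqVneq i j.
  - by move=> /andP[xj _] /andP[x'j _]; rewrite triE'.
  - by move=> xi x'i; rewrite triE'.
  - case/orP=> [/andP[xo yj]|/and3P[z0 xj /eqP->]].
      case/orP=> [/andP[_ y'j]|/and3P[z0 x'j _]]; first by rewrite triE' ?andbF.
      move: xo; rewrite (negPf z0) orbF => /eqP->.
      by case/andP=> /eqP ox'; rewrite -ox' irrE in x'j.
    case/orP=> [/andP[x'o _]|/and3P[_ _ /eqP->]]; last by rewrite irrE andbF.
    move: x'o; rewrite (negPf z0) orbF => /eqP->.
    by case/andP=> /eqP xo; rewrite xo irrE in xj.
  - by move=> /andP[_ yi] /andP[_ y'i]; rewrite triE' ?andbF.
(* Excludes triangles through both special vertices, whose joining edge has the single colour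
   [inl j]. *)
have disj c p : nbr true c p -> nbr false c p -> c == inl j -> False.
  by move=> + + /eqP ?; subst c; rewrite /= eqxx => /andP[-> /negPf->].
have base_tri c p q r : base c p q -> base c q r -> base c p r -> False.
  case: c => i /=; first by move=> a b; exact/negP/(triE _ _ _ _ a b).
  case/andP=> /eqP-> a /andP[/eqP-> b] /andP[_].
  exact/negP/(triE _ _ _ _ a b).
split=> //.
{ move=> c s t u st tu; apply/negP => su; move: st tu su.
  case: s t u => [p|] [q|] [r|] //=; rewrite ?if_same.
  all: try case: (p =P _) => [?|_]; try case: (q =P _) => [?|_].
  all: try case: (r =P _) => [?|_]; subst; rewrite ?nbr0 //.
  all: move=> a b d.
  all: first [ exact: (nbr_base _ _ _ _ a d b) | exact: (nbr_base _ _ _ _ a b d)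
    | exact: (nbr_base _ _ _ _ d b a) | exact: (base_tri _ _ _ _ a b d)
    | exact: (disj _ _ a b d) | exact: (disj _ _ a d b) | exact: (disj _ _ b a d)
    | exact: (disj _ _ b d a) | exact: (disj _ _ d a b) | exact: (disj _ _ d b a)]. }
have nbr_cov z p : p != (o, o) -> exists c, nbr z c p.
  case: p => x y; rewrite xpair_eqE negb_and.
  have [->|xo] /= := eqVneq x o.
    rewrite eq_sym => /covE[i oy]; exists (inr i).
    by rewrite /= eqxx /= oy; case: ifP oy => // /eqP-> ->.
  move=> _; have [i ox] : exists i, E i o x by apply: covE; rewrite eq_sym.
  have [ij|ij] := eqVneq i j; last by exists (inl i); rewrite /= (negPf ij).
  rewrite {i}ij in ox.
  have [zy|] := boolP (z (+) E j o y); first by exists (inl j); rewrite /= eqxx ox.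
  case: z => /=.
    rewrite negbK => oy; exists (inr j).
    by rewrite /= eqxx ox oy orbT.
  move=> oy; have [yo|] := eqVneq y o.
    by exists (inr j); rewrite /= eqxx ox yo eqxx orbT.
  (* Since [y] is not joined to [o] in colour [j], the colour [i] differs from [j]. *)
  rewrite eq_sym => /covE[i oyi]; exists (inr i); rewrite /= ox oyi orbT.
  by case: eqP oyi oy => // -> ->.
have base_cov p q : p != q -> exists c, base c p q.
  case: p q => [x y] [x' y']; rewrite xpair_eqE negb_and.
  have [->|/covE[i xx'] _] /= := eqVneq x x'; last by exists (inl i).
  by case/covE=> i yy'; exists (inr i); rewrite /= eqxx.
move=> [p|] [q|] //=.
- have [->|p0] := eqVneq p (o, o).
    by move=> zq; apply: nbr_cov; apply: contraNneq zq => ->.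
  by have [->|q0] := eqVneq q (o, o) => pq; [exact: nbr_cov | exact: base_cov].
- by have [_|p0 _] := eqVneq p (o, o); [exists (inl j) | exact: nbr_cov].
- by have [_|p0 _] := eqVneq q (o, o); [exists (inl j) | exact: nbr_cov].
Qed.

End Doubling.

(** * Supermultiplicativity and Fekete's lemma *)

Lemma alpha_gpowD (G : sgraph) (m n : nat) :
  (alpha (gpow G m) * alpha (gpow G n) <= alpha (gpow G (m + n)))%N.
Proof.
have [f [f_inj f_ind]] := alpha_attained (gpow G m).
have [g [g_inj g_ind]] := alpha_attained (gpow G n).
pose h (p : 'I_(alpha (gpow G m)) * 'I_(alpha (gpow G n))) : gpow G (m + n) :=
  [ffun i => match fintype.split i with inl a => f p.1 a | inr b => g p.2 b end].
have hl p a : h p (lshift n a) = f p.1 a by rewrite ffunE (unsplitK (inl a)).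
have hr p b : h p (rshift m b) = g p.2 b by rewrite ffunE (unsplitK (inr b)).
have h_inj : injective h.
  move=> [x y] [x' y'] e; congr (_, _).
    by apply: f_inj; apply/ffunP => a; rewrite -(hl (x, y)) -(hl (x', y')) e.
  by apply: g_inj; apply/ffunP => b; rewrite -(hr (x, y)) -(hr (x', y')) e.
rewrite -[X in (X * _ <= _)%N]card_ord -[X in (_ * X <= _)%N]card_ord -card_prod.
apply: (leq_alpha h_inj) => p q.
have [->|pq] := eqVneq p q; first by rewrite adj_irrefl.
apply/gprod_nadjP; first by rewrite (inj_eq h_inj).
have [e1|d1] := eqVneq p.1 q.1.
  have d2 : p.2 != q.2.
    by apply: contraNneq pq => e2; rewrite [p]surjective_pairing e1 e2 -surjective_pairing.
  have /gprod_nadjP[|b hb] := g_ind p.2 q.2; first by rewrite (inj_eq g_inj).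
  by exists (rshift m b); rewrite !hr.
have /gprod_nadjP[|a ha] := f_ind p.1 q.1; first by rewrite (inj_eq f_inj).
by exists (lshift n a); rewrite !hl.
Qed.

Lemma alpha_gpow_gt0 (G : sgraph) (n : nat) :
  (0 < alpha G)%N -> (0 < alpha (gpow G n))%N.
Proof.
have [f _] := alpha_attained G => aG.
rewrite -card_unit.
apply: (@leq_alpha (gpow G n) unit (fun=> [ffun=> f (Ordinal aG)])).
  by case=> [[]].
by move=> _ _; rewrite adj_irrefl.
Qed.

Lemma alpha_gpow_le (G : sgraph) (n : nat) :
  (alpha (gpow G n) <= #|G| ^ n)%N.
Proof.
apply/bigmax_leqP => A _; apply: leq_trans (max_card _) _.
by rewrite card_dep_ffun foldrE big_map big_enum /= prod_nat_const card_ord.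
Qed.

(** The limit is the supremum of the quotients: a nearly optimal one bounds all later ones from
    below through division with remainder. *)
Lemma fekete (R : realType) (f : nat -> R) (B : R) :
  (forall n, 0 <= f n) -> (forall m n, f m + f n <= f (m + n)%N) ->
  (forall n, f n <= n%:R * B) ->
  exists l, (f n / n%:R @[n --> \oo] --> l)%classic /\
    forall k, (0 < k)%N -> f k / k%:R <= l.
Proof.
move=> f_ge0 f_super f_le.
pose E : set R := [set f k.+1 / k.+1%:R | k in setT]%classic.
have E_ub : has_ubound E.
  by exists B => _ [k _ <-]; rewrite ler_pdivrMr ?ltr0Sn // mulrC f_le.
have E_sup : has_sup E by split; first by exists (f 1%N / 1%:R); exists 0%N.
have le_sup k : (0 < k)%N -> f k / k%:R <= sup E.
  by case: k => // k _; apply: ub_le_sup => //; exists k.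
have f_mul k q : q%:R * f k <= f (q * k)%N.
  elim: q => [|q IHq]; first by rewrite mul0r f_ge0.
  rewrite mulSn -natr1 mulrDl mul1r addrC.
  by apply: le_trans (f_super _ _); rewrite lerD2l.
exists (sup E); split=> //; apply/cvgrPdist_lt => /= e e0.
have e20 : 0 < e / 2 by rewrite divr_gt0.
have [_ [k _ <-] lt_k] := sup_adherent e20 E_sup.
near=> n.
have n_gt0 : (0 < n)%N by near: n; exact: nbhs_infty_gt.
have nR : 0 < n%:R :> R by rewrite ltr0n.
have kR : 0 < k.+1%:R :> R by rewrite ltr0n.
rewrite ger0_norm ?subr_ge0 ?le_sup //.
have fk_small : f k.+1 / n%:R < e / 2.
  rewrite ltr_pdivrMr // mulrC -ltr_pdivrMr //.
  by near: n; exact: nbhs_infty_gtr.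
(* The quotient of [n] by [k.+1] exceeds [n / k.+1 - 1], and the remainder contributes a nonnegative
   term. *)
have fn_ge : f k.+1 / k.+1%:R - f k.+1 / n%:R <= f n / n%:R.
  rewrite ler_pdivlMr // mulrBl divfK ?gt_eqF //.
  have: (n %/ k.+1)%:R * f k.+1 <= f n.
    apply: le_trans (f_mul _ _) _; rewrite {2}(divn_eq n k.+1).
    by apply: le_trans (f_super _ _); rewrite lerDl.
  apply: le_trans.
  have -> : f k.+1 / k.+1%:R * n%:R - f k.+1 = (n%:R / k.+1%:R - 1) * f k.+1.
    by ring.
  rewrite ler_wpM2r // lerBlDr ler_pdivrMr // natr1 -natrM ler_nat.
  by rewrite ltnW // ltn_ceil.
move: lt_k fk_small fn_ge; move: (f k.+1 / _) (f k.+1 / _) => x y; lra.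
Unshelve. all: by end_near.
Qed.

(** Fekete's lemma applies to the logarithm of [alpha (gpow G n)], which is at most [n] times that
    of [#|G|]. *)
Lemma ler_alpha_root_capacity (R : realType) (G : sgraph) (k : nat) :
  (0 < alpha G)%N -> (0 < k)%N -> alpha_root R G k <= shannon_capacity R G.
Proof.
move=> aG k0; pose f n : R := ln (alpha (gpow G n))%:R.
have a_gt0 n : 0 < (alpha (gpow G n))%:R :> R by rewrite ltr0n alpha_gpow_gt0.
have rootE n : alpha_root R G n = expR (f n / n%:R).
  by rewrite /alpha_root /powR gt_eqF // mulrC.
have f_ge0 n : 0 <= f n by rewrite ln_ge0 // ler1n alpha_gpow_gt0.
have f_super m n : f m + f n <= f (m + n)%N.
  by rewrite -lnM ?posrE // ler_ln ?posrE ?mulr_gt0 // -natrM ler_nat alpha_gpowD.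
have G_gt0 : (0 < #|G|)%N.
  by have [g _] := alpha_attained G; apply/card_gt0P; exists (g (Ordinal aG)).
have f_le n : f n <= n%:R * ln #|G|%:R.
  rewrite mulr_natl -lnXn ?ltr0n // ler_ln ?posrE ?exprn_gt0 ?ltr0n ?alpha_gpow_gt0 //.
  by rewrite -natrX ler_nat alpha_gpow_le.
have [l [f_cvg le_l]] := fekete f_ge0 f_super f_le.
have -> : shannon_capacity R G = expR l.
  apply: cvg_lim => //.
  under eq_fun do rewrite rootE.
  by apply: continuous_cvg => //; exact: continuous_expR.
by rewrite rootE ler_expR le_l.
Qed.

(** * Strictness from the extra vertex *)

Theorem theorem3 (R : realType) (C : R) (hC : sup_capacity R = C%:E)
    (G : sgraph) (hG : alpha G = 2%N) (n : nat) (hn : (0 < n)%N) :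
  alpha_root R G n < C.
Proof.
have [E E_cover] := cover_of_gpow n hG.
set m := alpha (gpow G n) in E E_cover.
have m_gt0 : (0 < m)%N by rewrite alpha_gpow_gt0 ?hG.
(* Any colour and any vertex can serve as [j] and [o]; the first ones exist because [n] and [m] are
   positive. *)
have D_cover := double_coverP (Ordinal hn) (Ordinal m_gt0) E_cover.
set D := double_cover _ _ _ in D_cover.
have card_V : #|{: option ('I_m * 'I_m)}| = (m ^ 2).+1.
  by rewrite card_option card_prod card_ord.
have aH : alpha (cover_graph D_cover) = 2%N.
  by rewrite alpha_cover_graph // card_V ltnS expn_gt0 m_gt0.
have := leq_alpha_gpow_cover D_cover.
rewrite card_V card_sum !card_ord; set H := cover_graph _ in aH * => lt_m2.
apply: (@lt_le_trans _ _ (alpha_root R H (n + n))); last first.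
  apply: (le_trans (ler_alpha_root_capacity R _ _)).
  - by rewrite aH.
  - by rewrite addn_gt0 hn.
  rewrite -lee_fin -hC; apply: ereal_sup_ubound.
  by exists H.
have nn : 0 < (n + n)%:R :> R by rewrite ltr0n addn_gt0 hn.
rewrite /alpha_root -/m.
(* This rewrites the left side as the [(n + n)]-th root of [m ^ 2], to be compared under the same
   root. *)
have -> : (n%:R^-1 : R) = 2%:R * (n + n)%:R^-1.
  by rewrite natrD; field; rewrite -natrD !pnatr_eq0 addn_eq0 andbb -lt0n hn.
rewrite powRrM powR_mulrn ?ler0n // -natrX.
by rewrite gt0_ltr_powR ?invr_gt0 ?nnegrE ?ler0n // ltr_nat.
Qed.
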